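(* There exists a family of cardinality $c = 2^{\aleph_0}$ consisting of compact subspaces of the Euclidean real line $\mathbb{R}$ such that no member of the family has a connected component which is a singleton, and such that any two distinct members of the family are not homeomorphic.
   Context: $c$ denotes the cardinality of $\mathbb{R}$. Subsets of $\mathbb{R}$ carry the subspace topology inherited from the Euclidean topology. *)

(* Defs.v *)
From mathcomp Require Import all_boot all_order all_algebra.
From mathcomp Require Import all_classical all_reals all_analysis.
Set Implicit Arguments.
Unset Strict Implicit.
Unset Printing Implicit Defensive.
Local Open Scope classical_set_scope.

Definition homeomorphic (T U : topologicalType) : Prop :=
  exists (f : T -> U) (g : U -> T),
    [/\ cancel f g, cancel g f, continuous f & continuous g].

(* Main.v *)
Require Import Defs.
From mathcomp Require Import all_boot all_order all_algebra.
From mathcomp Require Import all_classical all_reals all_analysis.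
From mathcomp Require Import ring lra.
Import Order.TTheory GRing.Theory Num.Theory.
Import numFieldNormedType.Exports.
Local Open Scope ring_scope.
Local Open Scope classical_set_scope.
Local Open Scope card_scope.

(** Iterate the derivative that keeps the points of [K] which are limits of
    surviving points of other components; only the two ends of a component can
    survive. Let [tower n] be an interval approached from the right by copies of
    [tower (n - 1)], with [tower 0] empty, so that no component has two surviving
    ends, and let [block k] be an interval approached from both sides by copies
    of [tower (k + 1)]: both its ends survive exactly [k + 1] derivatives. Having
    a component whose two ends both survive exactly [k + 1] derivatives is a
    topological property, so an interval approached by the blocks [block k] with
    [k] in [S] determines the set [S] of naturals. Taking for [S] the lower
    Dedekind cuts of the reals indexes the family by [R]. *)

(** * Components, iterated derivatives and their transport along maps *)

(** Components of a subset of the line are intervals, so this is the relation of lying in the same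
    component; the disjunction makes it symmetric. *)
Definition joined {R : realType} (K : set R) (x y : R) : Prop :=
  forall z, (x <= z <= y) || (y <= z <= x) -> K z.

Fixpoint derived {R : realType} (K : set R) (n : nat) (x : R) : Prop :=
  match n with
  | 0 => K x
  | n.+1 => K x /\ forall e, 0 < e ->
      exists y, [/\ derived K n y, `|x - y| < e & ~ joined K x y]
  end.

(** Two inner points of an interval already qualify for [n = 0]; only positive [n] detect ends. *)
Definition twin {R : realType} (n : nat) (K : set R) : Prop :=
  exists x y, [/\ x <> y, joined K x y,
    derived K n x /\ ~ derived K n.+1 x & derived K n y /\ ~ derived K n.+1 y].

Lemma joinedC {R : realType} {K : set R} {x y : R} :
  joined K x y -> joined K y x.
Proof. by move=> h z; rewrite orbC; exact: h. Qed.

Lemma derived_sub {R : realType} {K : set R} {n} {x : R} : derived K n x -> K x.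
Proof. by case: n => [//|n] []. Qed.

(* Only locality near V is required, so the lemma applies both to
   homeomorphisms and to the inclusion of a clopen piece. *)
Lemma derived_map {R : realType} (K L V : set R) (f : R -> R) n x :
  (forall x, V x -> K x -> L (f x)) ->
  (forall x e : R, V x -> K x -> 0 < e -> exists2 d : R, 0 < d &
     forall y, K y -> `|x - y| < d -> V y /\ `|f x - f y| < e) ->
  (forall x y, V x -> V y -> K x -> K y -> joined L (f x) (f y) ->
     joined K x y) ->
  V x -> derived K n x -> derived L n (f x).
Proof.
move=> fL cf fj; elim: n x => [|n IHn] x Vx /=; first exact: fL.
move=> [Kx Kd]; split=> [|e e0]; first exact: fL.
have [d d0 dP] := cf x e Vx Kx e0.
have [y [Ky xyd nxy]] := Kd d d0.
have Ky' := derived_sub Ky.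
have [Vy fxy] := dP y Ky' xyd.
by exists (f y); split=> [||/(fj x y Vx Vy Kx Ky')]; [exact: IHn|..].
Qed.

(** The inverse [g] carries surviving points of [L] back to [K], so [f] preserves not only survival
    but also its failure, hence the exact order of each point. *)
Lemma twin_map {R : realType} (K L : set R) (f g : R -> R) n :
  (forall x, K x -> L (f x)) -> (forall x, L x -> K (g x)) ->
  (forall x, K x -> g (f x) = x) -> (forall x, L x -> f (g x) = x) ->
  (forall x e : R, K x -> 0 < e -> exists2 d : R, 0 < d &
     forall y, K y -> `|x - y| < d -> `|f x - f y| < e) ->
  (forall x e : R, L x -> 0 < e -> exists2 d : R, 0 < d &
     forall y, L y -> `|x - y| < d -> `|g x - g y| < e) ->
  (forall x y, joined K x y -> joined L (f x) (f y)) ->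
  (forall x y, joined L x y -> joined K (g x) (g y)) ->
  twin n K -> twin n L.
Proof.
move=> fL gK fgK gfK cf cg fj gj.
have dg m y : K y -> derived L m (f y) -> derived K m y.
  move=> Ky; rewrite -{2}(fgK _ Ky).
  apply: (@derived_map _ L K setT) => //.
  - by move=> ? _; exact: gK.
  - move=> ? ? _ h1 h2; have [d d0 h] := cg _ _ h1 h2.
    by exists d => // ? ? ?; split=> //; exact: h.
  - by move=> u v _ _ h1 h2 /fj; rewrite !gfK.
have df m y : derived K m y -> derived L m (f y).
  apply: (@derived_map _ K L setT) => //.
  - by move=> ? _; exact: fL.
  - move=> ? ? _ h1 h2; have [d d0 h] := cf _ _ h1 h2.
    by exists d => // ? ? ?; split=> //; exact: h.
  - by move=> u v _ _ h1 h2 /gj; rewrite !fgK.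
move=> [x [y [xy jxy [dx ndx] [dy ndy]]]].
have Kx := derived_sub dx; have Ky := derived_sub dy.
exists (f x), (f y); split.
- by move=> h; apply: xy; rewrite -(fgK x)// h fgK.
- exact: fj.
- by split; [exact: df|move/dg; apply: contra_not ndx; exact].
- by split; [exact: df|move/dg; apply: contra_not ndy; exact].
Qed.

(** * Dyadic windows and their gaps *)

(* [zoom k] maps the interval between [1 / 2 ^+ k.+1] and [1 / 2 ^+ k] onto the
   interval between -3 and 3; as the teeth [A k] of a comb lie between -2 and 2,
   they are separated by gaps, hence clopen. *)
Definition zoom {R : realType} (k : nat) (t : R) : R := 12 * 2 ^+ k * t - 9.

Definition unzoom {R : realType} (k : nat) (z : R) : R :=
  (z + 9) / (12 * 2 ^+ k).

Lemma zoomK {R : realType} k (t : R) : unzoom k (zoom k t) = t.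
Proof. by rewrite /zoom /unzoom; field; rewrite expf_neq0. Qed.

Lemma unzoomK {R : realType} k (z : R) : zoom k (unzoom k z) = z.
Proof. by rewrite /zoom /unzoom; field; rewrite expf_neq0. Qed.

Lemma exp2_ge1 {R : realType} k : 1 <= 2 ^+ k :> R.
Proof. by rewrite exprn_ege1 // ler1n. Qed.

Lemma exp2_small {R : realType} {e : R} : 0 < e -> exists k, (2 ^+ k)^-1 < e.
Proof.
move=> e0; exists (Num.truncn e^-1); rewrite invf_plt ?posrE ?exprn_gt0//.
rewrite (lt_le_trans (truncnS_gt _)) // -natrX ler_nat.
by rewrite ltn_expl.
Qed.

Lemma ler_zoom {R : realType} k : {mono @zoom R k : s t / s <= t}.
Proof.
by move=> s t; rewrite /zoom lerD2r ler_pM2l // mulr_gt0 ?exprn_gt0.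
Qed.

Lemma ltr_zoom {R : realType} k : {mono @zoom R k : s t / s < t}.
Proof. by move=> s t; rewrite !ltNge ler_zoom. Qed.

Definition boxed {R : realType} (A : set R) := forall z, A z -> -2 <= z <= 2.

Lemma zoom_inj_level {R : realType} {j k} {t : R} :
  -3 < zoom j t < 3 -> -3 < zoom k t < 3 -> j = k.
Proof.
wlog lt_jk : j k / (j < k)%N => [th h1 h2|].
  by have [/th|/th|//] := ltngtP j k; [exact|move=> /(_ h2 h1)].
rewrite /zoom -(subnKC lt_jk) exprD exprS => /andP[h1 h2] /andP[h3 h4].
have := exp2_ge1 (R := R) (k - j.+1).
move: h1 h2 h3 h4; move: (2 ^+ (k - _)) (2 ^+ j) => {lt_jk} u s h1 h2 h3 h4 u1.
(* Level [j] gives [s * t > 1/2], level [k] gives [u * s * t < 1/2], and [u >= 1] makes these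
   incompatible. *)
have ? : 0 <= (u - 1) * (s * t) by apply: mulr_ge0; lra.
by exfalso; lra.
Qed.

Lemma zoom_box {R : realType} {k} {t : R} : -2 <= zoom k t <= 2 -> 0 < t < 1.
Proof.
by rewrite /zoom; have := exp2_ge1 (R := R) k; move: (2 ^+ k) => *; nra.
Qed.

(** The dyadic point zooms to at least 3 when [k <= j], and to at most -3 otherwise. *)
Lemma zoom_gap {R : realType} k j : ~ (-2 <= zoom j ((2 ^+ k)^-1 : R) <= 2).
Proof.
rewrite /zoom; have [kj|jk] := leqP k j.
  rewrite -(subnKC kj) exprD -mulrA mulrAC mulfV ?expf_neq0 // mul1r.
  by have := exp2_ge1 (R := R) (j - k) => *; lra.
rewrite -(subnKC jk) exprD exprS.
have -> : 12 * 2 ^+ j * (2 * 2 ^+ j * 2 ^+ (k - j.+1))^-1 - 9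
    = 6 * (2 ^+ (k - j.+1))^-1 - 9 :> R.
  by field; rewrite !expf_neq0.
have := exp2_ge1 (R := R) (k - j.+1); rewrite -invf_le1 ?exprn_gt0 // => *; lra.
Qed.

Lemma zoom_gapP {R : realType} k (t : R) :
  (-3 < zoom k t < 3) = ((2 ^+ k.+1)^-1 < t < (2 ^+ k)^-1).
Proof.
have <- : zoom k (2 ^+ k.+1)^-1 = -3 :> R.
  by rewrite /zoom exprS; field; rewrite expf_neq0.
have <- : zoom k (2 ^+ k)^-1 = 3 :> R.
  by rewrite /zoom; field; rewrite expf_neq0.
by rewrite !ltr_zoom.
Qed.

(** * Combs: survival on a tooth *)

(** The teeth [A k] shrink to the end 1 of the core, and the mirrored teeth [A' k] to the end -1. *)
Definition comb {R : realType} (A A' : nat -> set R) : set R :=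
  [set x | [\/ -1 <= x <= 1, exists k, A k (zoom k (x - 1))
             | exists k, A' k (zoom k (- x - 1))]].

Section Teeth.
Context {R : realType} {A A' : nat -> set R}.
Hypothesis bA : forall k, boxed (A k).
Hypothesis bA' : forall k, boxed (A' k).

(** This lets combs serve in turn as teeth of further combs. *)
Lemma comb_boxed : boxed (comb A A').
Proof.
move=> x [|[k /bA/zoom_box]|[k /bA'/zoom_box]]; lra.
Qed.

Lemma comb_gt1 {x : R} : comb A A' x -> 1 < x ->
  exists k, A k (zoom k (x - 1)).
Proof. by move=> [?|//|[k /bA'/zoom_box ?]] ?; exfalso; lra. Qed.

Lemma comb_zoom {k} {x : R} : -3 < zoom k (x - 1) < 3 -> comb A A' x ->
  A k (zoom k (x - 1)).
Proof.
move=> xk Mx; have x1 : 1 < x.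
  have : 0 < (2 ^+ k.+1)^-1 :> R by rewrite invr_gt0 exprn_gt0.
  by move: xk; rewrite zoom_gapP; lra.
have [j Aj] := comb_gt1 Mx x1.
suff -> : k = j by [].
by apply: zoom_inj_level xk _; move: (bA _ _ Aj); lra.
Qed.

(** These missing points bound the windows, so no component leaves the window it starts in. *)
Lemma comb_gap k : ~ comb A A' (1 + (2 ^+ k)^-1).
Proof.
have k0 : 0 < (2 ^+ k)^-1 :> R by rewrite invr_gt0 exprn_gt0.
move=> /comb_gt1[|j /bA]; first by lra.
by rewrite addrC addKr; exact: zoom_gap.
Qed.

Lemma joined_piece {k} {x y : R} : -3 < zoom k (x - 1) < 3 ->
  joined (comb A A') x y -> -3 < zoom k (y - 1) < 3.
Proof.
rewrite !zoom_gapP => xk jxy.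
apply/andP; split; rewrite ltNge; apply/negP => yk.
- by apply: (comb_gap k.+1); apply: jxy; apply/orP; right; lra.
- by apply: (comb_gap k); apply: jxy; apply/orP; left; lra.
Qed.

Lemma joined_zoom {k} {x y : R} : -3 < zoom k (x - 1) < 3 ->
  joined (comb A A') x y -> joined (A k) (zoom k (x - 1)) (zoom k (y - 1)).
Proof.
move=> xk jxy z zxy; have yk := joined_piece xk jxy.
have zE : z = zoom k (1 + unzoom k z - 1) by rewrite addrC addKr unzoomK.
rewrite zE in zxy *; move: zxy; rewrite !ler_zoom => zxy.
apply: comb_zoom; last by apply: jxy; lra.
move: xk yk; rewrite !zoom_gapP; lra.
Qed.

Lemma zoom_joined {k} {x y : R} :
  joined (A k) (zoom k (x - 1)) (zoom k (y - 1)) -> joined (comb A A') x y.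
Proof.
move=> j z zxy; apply: Or32; exists k; apply: j.
by rewrite !ler_zoom; lra.
Qed.

Lemma zoom_dist k (x y : R) :
  `|zoom k x - zoom k y| = 12 * 2 ^+ k * `|x - y|.
Proof.
rewrite /zoom opprB addrA subrK -mulrBr normrM ger0_norm //.
Qed.

(** A tooth is clopen in the comb and [zoom k] is affine, so [derived_map] applies both ways: to the
    rescaling into the comb, and to its inverse near the window. *)
Lemma derived_piece {n k} {x : R} : -3 < zoom k (x - 1) < 3 ->
  derived (comb A A') n x <-> derived (A k) n (zoom k (x - 1)).
Proof.
move=> xk; have u0 : 0 < 12 * 2 ^+ k :> R by rewrite mulr_gt0 ?exprn_gt0.
split; last first.
  pose f z : R := 1 + unzoom k z.
  have fK z : zoom k (f z - 1) = z by rewrite /f addrC addKr unzoomK.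
  have {2}-> : x = f (zoom k (x - 1)) by rewrite /f zoomK addrC subrK.
  apply: (@derived_map _ _ _ setT) => //.
  - by move=> z _ Az; apply: Or32; exists k; rewrite fK.
  - move=> z e _ _ e0; exists (12 * 2 ^+ k * e); first exact: mulr_gt0.
    move=> y _; rewrite -{1}(fK z) -{1}(fK y) zoom_dist ltr_pM2l //.
    by rewrite opprB addrA subrK.
  - move=> z y _ _ Az Ay /(@joined_zoom k); rewrite !fK; apply.
    by have := bA _ _ Az; lra.
apply: (@derived_map _ _ _ [set x | -3 < zoom k (x - 1) < 3]
  (fun x => zoom k (x - 1))) => //.
- by move=> z; exact: comb_zoom.
- move=> z e /= zk _ e0; move: (zk); rewrite zoom_gapP => ?.
  (* The first bound accounts for the slope of [zoom k]; the others keep [y] inside the window. *)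
  exists (Num.min (e / (12 * 2 ^+ k))
    (Num.min (z - 1 - (2 ^+ k.+1)^-1) ((2 ^+ k)^-1 - (z - 1)))).
    by rewrite !lt_min divr_gt0 //=; lra.
  move=> y _; rewrite !lt_min => /andP[d1 d2]; split.
    by rewrite zoom_gapP; move: d2; rewrite !ltr_norml; lra.
  by rewrite zoom_dist -ltr_pdivlMl // mulrC opprB addrA subrK.
- by move=> z y _ _ _ _; exact: zoom_joined.
Qed.

End Teeth.

(** * Reflection, which exchanges the two sides of a comb *)

Lemma combN {R : realType} {A A' : nat -> set R} {x : R} :
  comb A A' x -> comb A' A (- x).
Proof.
move=> [x1|h|h]; [apply: Or31; lra|apply: Or33|by apply: Or32].
by rewrite opprK.
Qed.

Lemma joinedN {R : realType} {A A' : nat -> set R} {x y : R} :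
  joined (comb A A') x y -> joined (comb A' A) (- x) (- y).
Proof.
by move=> j z zxy; rewrite -(opprK z); apply/combN/j; lra.
Qed.

Lemma derivedN {R : realType} {A A' : nat -> set R} {n} {x : R} :
  derived (comb A A') n x -> derived (comb A' A) n (- x).
Proof.
apply: (@derived_map _ _ _ setT) => //.
- by move=> y _ /combN.
- move=> y e _ _ e0; exists e => // z _ zy; split=> //.
  by rewrite -opprD normrN.
- by move=> y z _ _ _ _ /joinedN; rewrite !opprK.
Qed.

(** * Survival at the ends of the core *)

Section Core.
Context {R : realType} {A A' : nat -> set R}.
Hypothesis bA : forall k, boxed (A k).
Hypothesis bA' : forall k, boxed (A' k).

Lemma joined_core {x y : R} : -1 <= x <= 1 -> -1 <= y <= 1 ->
  joined (comb A A') x y.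
Proof. by move=> *; move=> z ?; apply: Or31; lra. Qed.

Lemma derived_core {n} {x : R} : -1 <= x <= 1 ->
  derived (comb A A') n.+1 x -> x = 1 \/ x = -1.
Proof.
move=> x1 [_ dx]; have [->|xn1] := eqVneq x 1; first by left.
have [->|xnN1] := eqVneq x (-1); first by right.
exfalso.
have lx : -1 < x by rewrite lt_neqAle eq_sym xnN1; lra.
have xl : x < 1 by rewrite lt_neqAle xn1; lra.
(* Within the distance to the nearer end, every point belongs to the core. *)
have [|y [_ xy []]] := dx (Num.min (1 - x) (1 + x)).
  by rewrite lt_min; lra.
apply: joined_core => //; move: xy; rewrite lt_min !ltr_norml; lra.
Qed.

Lemma derived_end {n} : derived (comb A A') n.+1 1 ->
  exists k z, derived (A k) n z.
Proof.
(* Radius 1 keeps [y] positive, so a [y] not joined to 1 lies to the right of the core. *)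
move=> [_ /(_ 1 ltr01)][y [dy y1 njy]].
have y_gt1 : 1 < y.
  rewrite ltNge; apply/negP => ?; apply: njy; apply: joined_core; first lra.
  by move: y1; rewrite ltr_norml; lra.
have [k Ak] := comb_gt1 bA' (derived_sub dy) y_gt1.
exists k, (zoom k (y - 1)); apply/(derived_piece bA bA') => //.
by have := bA _ _ Ak; lra.
Qed.

(** The tooth of level [k] lies within [(2 ^+ k)^-1] of 1, so surviving points of the teeth
    accumulate at 1. With [derived_end], the end 1 survives exactly one derivative more than equal
    teeth do. *)
Lemma end_derived {n} : (forall k, exists z, derived (A k) n z) ->
  derived (comb A A') n.+1 1.
Proof.
move=> dA; split=> [|e e0]; first by apply: Or31; lra.
have [k ke] := exp2_small e0.
have [z dz] := dA k; pose y := 1 + unzoom k z.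
have zE : z = zoom k (y - 1) by rewrite /y addrC addKr unzoomK.
have zb := bA _ _ (derived_sub dz).
have yk : -3 < zoom k (y - 1) < 3 by rewrite -zE; lra.
exists y; split.
- by apply/(derived_piece bA bA' yk); rewrite -zE.
- have y0 : 0 < (2 ^+ k.+1)^-1 :> R by rewrite invr_gt0 exprn_gt0.
  by move: yk; rewrite zoom_gapP ltr_norml; lra.
(* Were they joined, 1 would lie in the window of [y], but it zooms to -9. *)
- move=> /joinedC/(joined_piece bA bA' yk).
  rewrite subrr /zoom; lra.
Qed.

Lemma derived_comb {n} {x : R} : derived (comb A A') n.+1 x ->
  [\/ exists k, -2 <= zoom k (x - 1) <= 2,
      exists k, -2 <= zoom k (- x - 1) <= 2, x = 1 | x = -1].
Proof.
move=> dx; have [x1|[k /bA ?]|[k /bA' ?]] := derived_sub dx.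
- by have [] := derived_core x1 dx => ?; [apply: Or43|apply: Or44].
- by apply: Or41; exists k.
- by apply: Or42; exists k.
Qed.

(** * Twins of a comb *)

Lemma twin_piece {n k} : twin n (A k) -> twin n (comb A A').
Proof.
move=> [x [y [xy jxy [dx ndx] [dy ndy]]]].
have bx := bA _ _ (derived_sub dx); have by_ := bA _ _ (derived_sub dy).
pose f z : R := 1 + unzoom k z.
have fK z : zoom k (f z - 1) = z by rewrite /f addrC addKr unzoomK.
have df m z : -2 <= z <= 2 -> derived (comb A A') m (f z) <-> derived (A k) m z.
  move=> zb; rewrite -[z in X in _ <-> X]fK; apply: (derived_piece bA bA').
  by rewrite fK; lra.
exists (f x), (f y); split.
- by move=> h; apply: xy; rewrite -(fK x) h fK.
- by apply: (@zoom_joined _ _ _ k); rewrite !fK.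
- by rewrite !df.
- by rewrite !df.
Qed.
End Core.

(** The component of [x] stays in its tooth, so both points zoom into [A k] with their orders
    unchanged. *)
Lemma twin_piece_inv {R : realType} {A A' : nat -> set R} {n k} {x y : R} :
  (forall k, boxed (A k)) -> (forall k, boxed (A' k)) ->
  -2 <= zoom k (x - 1) <= 2 -> x <> y -> joined (comb A A') x y ->
  derived (comb A A') n x /\ ~ derived (comb A A') n.+1 x ->
  derived (comb A A') n y /\ ~ derived (comb A A') n.+1 y ->
  twin n (A k).
Proof.
move=> bA bA' xk xy jxy.
have {}xk : -3 < zoom k (x - 1) < 3 by lra.
have yk := joined_piece bA bA' xk jxy.
rewrite !(derived_piece bA bA' xk) !(derived_piece bA bA' yk) => dx dy.
exists (zoom k (x - 1)), (zoom k (y - 1)); split => //.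
- move/(congr1 (unzoom k)); rewrite !zoomK => /(congr1 (+%R^~ 1)).
  by rewrite !subrK.
- exact: (joined_zoom bA bA').
Qed.

(** A pair in one component lies in a right tooth, in a left tooth or in the core, where only 1 and
    -1 survive a derivative. Survival of -1 is expressed at 1 in the reflected comb. *)
Lemma twin_combP {R : realType} {A A' : nat -> set R} {n} :
  (forall k, boxed (A k)) -> (forall k, boxed (A' k)) ->
  twin n.+1 (comb A A') ->
  [\/ exists k, twin n.+1 (A k), exists k, twin n.+1 (A' k) |
    [/\ derived (comb A A') n.+1 1, derived (comb A' A) n.+1 1 &
      ~ derived (comb A A') n.+2 1]].
Proof.
move=> bA bA' [x [y [xy jxy dx dy]]].
pose M := comb A A'.
have right u v k : -2 <= zoom k (u - 1) <= 2 -> u <> v -> joined M u v ->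
    derived M n.+1 u /\ ~ derived M n.+2 u ->
    derived M n.+1 v /\ ~ derived M n.+2 v ->
    exists k, twin n.+1 (A k).
  by move=> uk uv juv du dv; exists k; exact: twin_piece_inv uk uv juv du dv.
have left u v k : -2 <= zoom k (- u - 1) <= 2 -> u <> v -> joined M u v ->
    derived M n.+1 u /\ ~ derived M n.+2 u ->
    derived M n.+1 v /\ ~ derived M n.+2 v ->
    exists k, twin n.+1 (A' k).
  have dN w : derived M n.+1 w /\ ~ derived M n.+2 w ->
      derived (comb A' A) n.+1 (- w) /\ ~ derived (comb A' A) n.+2 (- w).
    by move=> [? nw]; split=> [|/derivedN]; [exact: derivedN|rewrite opprK].
  move=> uk uv juv /dN du /dN dv; exists k.
  have uvN : - u <> - v by move/oppr_inj.
  exact: twin_piece_inv uk uvN (joinedN juv) du dv.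
have /joinedC jyx := jxy.
have yx : y <> x by move=> /esym.
have [[k xk]|[k xk]|x1|x1] := derived_comb bA bA' dx.1.
- by apply: Or31; exact: right xk xy jxy dx dy.
- by apply: Or32; exact: left xk xy jxy dx dy.
- have [[k yk]|[k yk]|y1|y1] := derived_comb bA bA' dy.1.
  + by apply: Or31; exact: right yk yx jyx dy dx.
  + by apply: Or32; exact: left yk yx jyx dy dx.
  + by rewrite x1 y1 in xy.
  + subst x y; apply: Or33; split; [exact: dx.1| |exact: dx.2].
    by rewrite -(opprK 1); apply: derivedN; exact: dy.1.
- have [[k yk]|[k yk]|y1|y1] := derived_comb bA bA' dy.1.
  + by apply: Or31; exact: right yk yx jyx dy dx.
  + by apply: Or32; exact: left yk yx jyx dy dx.
  + subst x y; apply: Or33; split; [exact: dy.1| |exact: dy.2].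
    by rewrite -(opprK 1); apply: derivedN; exact: dx.1.
  + by rewrite x1 y1 in xy.
Qed.

(** * Towers, blocks and coded sets *)

Fixpoint tower {R : realType} (n : nat) : set R :=
  if n is n.+1 then comb (fun=> tower n) (fun=> set0) else set0.

Definition block {R : realType} (k : nat) : set R :=
  comb (fun=> tower k.+1) (fun=> tower k.+1).

(** Slots whose index is outside [S] stay empty. *)
Definition coded {R : realType} (S : set nat) : set R :=
  comb (fun k => [set x | S k /\ block k x]) (fun=> set0).

Lemma boxed0 {R : realType} : boxed (@set0 R).
Proof. by []. Qed.

Lemma tower_boxed {R : realType} n : boxed (@tower R n).
Proof.
by elim: n => [//|n IHn]; exact: comb_boxed (fun=> IHn) (fun=> boxed0).
Qed.

Lemma block_boxed {R : realType} k : boxed (@block R k).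
Proof. by apply: comb_boxed => _; exact: tower_boxed. Qed.

Lemma coded_boxed {R : realType} S : boxed (@coded R S).
Proof.
by apply: comb_boxed => [k x [_]|_]; [exact: block_boxed|exact: boxed0].
Qed.

Lemma derived0 {R : realType} n (x : R) : ~ derived set0 n x.
Proof. by move=> /derived_sub. Qed.

(** Each new storey adds one derivative, survived by its end 1; its bare end -1 survives none. *)
Lemma derived_tower {R : realType} n j :
  (exists x, derived (@tower R n) j x) <-> (j < n)%N.
Proof.
have tb n := @tower_boxed R n.
elim: n j => [|n IHn] [|j].
- by split=> // -[x /(derived0 0)].
- by split=> // -[x /(derived0 j.+1)].
- by split=> // _; exists 0; apply: Or31; lra.
rewrite ltnS; split=> [[x dx]|/IHn dj]; last first.
  have ? := end_derived (fun=> tb n) (fun=> boxed0) (fun=> dj). by exists 1.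
have [[k xk]|[k xk]|x1|x1] := derived_comb (fun=> tb n) (fun=> boxed0) dx.
- apply: ltnW; apply/IHn; exists (zoom k (x - 1)).
  by apply/(derived_piece (fun=> tb n) (fun=> boxed0)); [lra|].
- move/derivedN: dx => /(derived_piece (fun=> boxed0) (fun=> tb n)) -/(_ k).
  by move=> H; exfalso; apply: derived0 (H _); lra.
- rewrite x1 in dx.
  by have [_ ?] := derived_end (fun=> tb n) (fun=> boxed0) dx; exact/IHn.
- move/derivedN: dx; rewrite x1 opprK.
  by move=> /(derived_end (fun=> boxed0) (fun=> tb n))[k [z /derived0]].
Qed.

(** A twin on a core would need teeth accumulating at -1, where a tower has none. *)
Lemma tower_twin {R : realType} n j : ~ twin j.+1 (@tower R n).
Proof.
elim: n => [|n IHn]; first by move=> [x [y [_ _ [/(derived0 j.+1)]]]].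
move=> /(twin_combP (fun=> tower_boxed n) (fun=> boxed0))[[_ //]|[k]|].
  by move=> [x [y [_ _ [/(derived0 j.+1)]]]].
move=> [_ /(derived_end (fun=> boxed0) (fun=> tower_boxed n))[k [z]]].
by move/derived0.
Qed.

Lemma block_twin {R : realType} k j : twin j.+1 (@block R k) <-> j = k.
Proof.
have tb : nat -> boxed (@tower R k.+1) by move=> _; exact: tower_boxed.
split=> [|->].
- move=> /(twin_combP tb tb)[[_ /tower_twin//]|[_ /tower_twin//]|].
  (* Survival of [j.+1] derivatives gives [j <= k]; failure at [j.+2] rules out [j < k]. *)
  move=> [/(derived_end tb tb)[_ /derived_tower jk] _ nd].
  apply/eqP; rewrite eqn_leq -ltnS jk leqNgt /=; apply/negP => kj.
  by apply: nd; apply: (end_derived tb tb) => _; exact/derived_tower.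
- have d1 : derived (@block R k) k.+1 1.
    by apply: (end_derived tb tb) => _; exact/derived_tower.
  have nd1 : ~ derived (@block R k) k.+2 1.
    by move=> /(derived_end tb tb)[_ /derived_tower]; rewrite ltnn.
  exists 1, (-1); split=> //.
  + by move=> ?; lra.
  + by apply: joined_core; lra.
  + by split=> [|/derivedN]; [exact: derivedN|rewrite opprK].
Qed.

(** The core contributes no twin, its end -1 being bare, so every twin of positive order comes from
    a block present in [S]. *)
Lemma coded_twin {R : realType} S k : twin k.+1 (@coded R S) <-> S k.
Proof.
have bB i : boxed [set x | S i /\ @block R i x].
  by move=> x [_]; exact: block_boxed.
have BE i : S i -> [set x | S i /\ @block R i x] = block i.
  by move=> Si; apply/seteqP; split=> x //= [].
split=> [|Sk].
- move=> /(twin_combP bB (fun=> boxed0))[[i Bi]|[i]|].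
  + have Si : S i by case: Bi => x [y [_ _ [/derived_sub[]]]].
    by move: Bi; rewrite BE // => /block_twin ->.
  + by move=> [x [y [_ _ [/(derived0 k.+1)]]]].
  + by move=> [_ /(derived_end (fun=> boxed0) bB)[i [z /derived0]]].
- apply: (twin_piece bB (fun=> boxed0) (k := k)).
  by rewrite BE //; exact/block_twin.
Qed.

(** * Absence of singleton components *)

Definition fat {R : realType} (K : set R) : Prop :=
  forall x, K x -> exists y, x <> y /\ joined K x y.

Lemma comb_fat {R : realType} (A A' : nat -> set R) :
  (forall k, fat (A k)) -> (forall k, fat (A' k)) -> fat (comb A A').
Proof.
have right (B B' : nat -> set R) k x : fat (B k) -> B k (zoom k (x - 1)) ->
    exists y, x <> y /\ joined (comb B B') x y.
  move=> fB /fB[z [xz jxz]]; exists (1 + unzoom k z).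
  have zE : z = zoom k (1 + unzoom k z - 1) by rewrite addrC addKr unzoomK.
  split=> [xE|]; first by apply: xz; rewrite xE -zE.
  by apply: (@zoom_joined _ _ _ k); rewrite -zE.
move=> fA fA' x [x1|[k]|[k]]; last 2 first.
- exact: right.
- move=> /right-/(_ A)[//|y [xy jxy]]; exists (- y); split.
    by move=> xE; apply: xy; rewrite xE opprK.
  by rewrite -(opprK x); exact: joinedN.
have [->|x0] := eqVneq x 0.
  by exists 1; split; [move=> ?; lra|apply: joined_core; lra].
by exists 0; split; [exact/eqP|apply: joined_core; lra].
Qed.

Lemma coded_fat {R : realType} S : fat (@coded R S).
Proof.
have f0 : fat (@set0 R) by [].
have tf n : fat (@tower R n).
  by elim: n => [//|n IHn]; exact: comb_fat (fun=> IHn) (fun=> f0).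
apply: comb_fat => [k|//] x [Sk].
move=> /(comb_fat _ _ (fun=> tf _) (fun=> tf _))[y [xy jxy]].
by exists y; split=> // z /jxy.
Qed.

(** The whole segment from [x] to its partner [z] is connected, hence inside the component. *)
Lemma fat_component {R : realType} (K : set R) x : fat K -> K x ->
  ~ exists y, connected_component K x = [set y].
Proof.
move=> fK /fK[z [xz jxz]] [y cE].
have sub t : (x <= t <= z) || (z <= t <= x) -> t = y.
  move=> tP; suff : connected_component K x t by rewrite cE.
  pose C : set R := [set t | (x <= t <= z) || (z <= t <= x)].
  apply: (@connected_component_max _ K C) => //.
  - by rewrite /C /= lexx; case: leP => //= /ltW ->.
  - by apply/connected_intervalP => a b; rewrite /C /= => ? ? c ?; lra.
apply: xz; transitivity y; [|symmetry]; apply: sub; rewrite lexx ?andbT.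
- by case: leP => //= /ltW ->.
- by case: leP => //= /ltW ->.
Qed.

(** * Compactness *)

Lemma closed_comb {R : realType} (A A' : nat -> set R) :
  (forall k, boxed (A k)) -> (forall k, boxed (A' k)) ->
  (forall k, closed (A k)) -> (forall k, closed (A' k)) -> closed (comb A A').
Proof.
move=> bA bA' cA cA'.
pose P k := (fun x => zoom k (x - 1)) @^-1` A k `|`
  (fun x => zoom k (- x - 1)) @^-1` A' k.
have cP k : closed (P k).
  have cz : continuous (@zoom R k).
    by move=> x; apply: cvgB; [apply: cvgM => //|]; exact: cvg_cst.
  apply: closedU.
  - move: (A k) (cA k); apply/(@continuous_closedP R R) => x.
    apply: (@continuous_comp R R R (fun x => x - 1) (zoom k)); last exact: cz.
    by apply: cvgB => //; exact: cvg_cst.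
  - move: (A' k) (cA' k); apply/(@continuous_closedP R R) => x.
    apply: (@continuous_comp R R R (fun x => - x - 1) (zoom k)); last exact: cz.
    by apply: cvgB; [exact: cvgN|exact: cvg_cst].
(* Only finitely many teeth stick out of a slightly enlarged core. *)
suff -> : comb A A' = \bigcap_n
    (`[-1 - (2 ^+ n)^-1, 1 + (2 ^+ n)^-1]%classic `|` \bigcup_(k in `I_n) P k).
  apply: closed_bigI => n _; apply: closedU; first exact: interval_closed.
  exact: closed_bigcup.
(* From level [n] on, the teeth lie within [(2 ^+ n)^-1] of the core. *)
have small n k (t : R) : -2 <= zoom k t <= 2 -> (n <= k)%N -> t < (2 ^+ n)^-1.
  move=> tk nk; apply: (@lt_le_trans _ _ (2 ^+ k)^-1).
    by have : -3 < zoom k t < 3 by [lra]; rewrite zoom_gapP => /andP[].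
  by rewrite lef_pV2 ?posrE ?exprn_gt0// ler_eXn2l// ltr1n.
apply/seteqP; split=> x.
- move=> Mx n _ /=.
  have n0 : 0 < (2 ^+ n)^-1 :> R by rewrite invr_gt0 exprn_gt0.
  case: Mx => [x1|[k Ak]|[k Ak]].
  + by left; rewrite in_itv /=; lra.
  + have [nk|kn] := leqP n k; last by right; exists k => //; left.
    have := zoom_box (bA _ _ Ak); have := small _ _ _ (bA _ _ Ak) nk.
    by left; rewrite in_itv /=; lra.
  + have [nk|kn] := leqP n k; last by right; exists k => //; right.
    have := zoom_box (bA' _ _ Ak); have := small _ _ _ (bA' _ _ Ak) nk.
    by left; rewrite in_itv /=; lra.
- move=> capx; have [x1|x1] := boolP (-1 <= x <= 1); first exact: Or31.
  (* The maximum is the distance from [x] to the core, positive here. *)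
  have [n nx] : exists n, (2 ^+ n)^-1 < Num.max (x - 1) (- x - 1).
    by apply: exp2_small; rewrite lt_max; lra.
  have [|[k _ [?|?]]] := capx n I;
    [|by apply: Or32; exists k|by apply: Or33; exists k].
  by move: nx; rewrite /= in_itv /= lt_max; lra.
Qed.

Lemma coded_compact {R : realType} S : compact (@coded R S).
Proof.
have tc n : closed (@tower R n).
  elim: n => [|n IHn]; first exact: closed0.
  apply: closed_comb => // _; [exact: tower_boxed|exact: boxed0|exact: closed0].
apply: (@subclosed_compact R _ `[-2, 2]%classic).
- apply: closed_comb => [k x [_]|_|k|_];
    [exact: block_boxed|exact: boxed0| |exact: closed0].
  have [Sk|nSk] := pselect (S k); last first.
    rewrite (_ : mkset _ = set0); first exact: closed0.
    by apply/seteqP; split=> x //= [].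
  rewrite (_ : mkset _ = block k); last by apply/seteqP; split=> x //= [].
  by apply: closed_comb => // _; exact: tower_boxed.
- exact: segment_compact.
- by move=> x /coded_boxed; rewrite /= in_itv.
Qed.

(** * Topological invariance of twins *)

(** The image of the segment is connected, hence an interval, and so covers everything between [f x]
    and [f y]. *)
Lemma within_continuous_joined {R : realType} (K L : set R) (f : R -> R) x y :
  {within K, continuous f} -> (forall x, K x -> L (f x)) ->
  joined K x y -> joined L (f x) (f y).
Proof.
wlog xy : x y / x <= y => [th cf fL jxy|cf fL jxy z zxy].
  have [xy|/ltW yx] := leP x y; first exact: th.
  exact/joinedC/th/joinedC.
have sub : `[x, y]%classic `<=` K.
  by move=> t; rewrite /= in_itv /= => txy; apply: jxy; rewrite txy.
have /connected_intervalP If : connected (f @` `[x, y]).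
  apply: connected_continuous_connected; first exact: segment_connected.
  exact: continuous_subspaceW cf.
have fx : (f @` `[x, y]) (f x) by exists x; rewrite //= in_itv /= lexx.
have fy : (f @` `[x, y]) (f y) by exists y; rewrite //= in_itv /= lexx xy.
have [t /sub Kt <-] : (f @` `[x, y]) z; last exact: fL.
by case/orP: zxy => ?; [exact: If fx fy _ _|exact: If fy fx _ _].
Qed.

Lemma within_continuous_dist {R : realType} (K : set R) (f : R -> R) (x e : R) :
  {within K, continuous f} -> K x -> 0 < e ->
  exists2 d : R, 0 < d & forall y, K y -> `|x - y| < d -> `|f x - f y| < e.
Proof.
move=> /subspace_continuousP cf Kx e0.
move/cvgrPdist_lt: (cf x Kx) => /(_ e e0).
rewrite near_withinE => /nbhs_ballP[d d0 dP].
by exists d => // y Ky xy; exact: (dP y xy Ky).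
Qed.

Lemma homeomorphic_twin {R : realType} (K L : set R) n :
  homeomorphic (set_type K) (set_type L) -> twin n K -> twin n L.
Proof.
move=> [f [g [fgK gfK cf cg]]].
(* Maps between subspaces are extended by 0 to the line; continuity is then claimed only within
   [M]. *)
pose lift M N (h : set_type M -> set_type N) : R -> R := valL_ 0 (set_val \o h).
have ext (M N : set R) (h : set_type M -> set_type N) : continuous h ->
    {within M, continuous (lift _ _ h)}.
  move=> ch; apply/subspace_valL_continuousP' => x.
  by apply: continuous_comp; [exact: ch|exact: initial_continuous].
have extE (M N : set R) (h : set_type M -> set_type N) x (Mx : M x) :
    lift _ _ h x = set_val (h (SigSub (mem_set Mx))).
  exact: (congr1 (fun F => F (SigSub (mem_set Mx))) (valLK 0 (set_val \o h))).
have ext_in (M N : set R) (h : set_type M -> set_type N) x : M x ->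
    N (lift _ _ h x).
  by move=> Mx; rewrite (extE _ _ _ _ Mx); exact: set_valP.
have extK (M N : set R) (h : set_type M -> set_type N) h' x :
    cancel h h' -> M x -> lift _ _ h' (lift _ _ h x) = x.
  move=> hK Mx; have Nhx := ext_in _ _ h _ Mx.
  rewrite (extE _ _ h' _ Nhx) (_ : SigSub _ = h (SigSub (mem_set Mx))) ?hK//.
  by apply: val_inj; rewrite /= (extE _ _ _ _ Mx).
apply: (@twin_map _ _ _ (lift _ _ f) (lift _ _ g)).
- by move=> x; exact: ext_in.
- by move=> x; exact: ext_in.
- by move=> x; exact: extK.
- by move=> x; exact: extK.
- by move=> x e; apply: within_continuous_dist; exact: ext.
- by move=> x e; apply: within_continuous_dist; exact: ext.
- by move=> x y; apply: within_continuous_joined; [exact: ext|exact: ext_in].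
- by move=> x y; apply: within_continuous_joined; [exact: ext|exact: ext_in].
Qed.

(** * Dedekind cuts and the family *)

Definition cut {R : realType} (r : R) : set nat :=
  [set n | exists2 q : rat, pickle q = n & ratr q < r].

(** A rational strictly between two reals belongs to the cut of the larger one only. *)
Lemma cut_inj {R : realType} : injective (@cut R).
Proof.
have cut_le (r s : R) : cut r = cut s -> r <= s.
  move=> rs; rewrite leNgt; apply/negP => /rat_in_itvoo[q].
  rewrite in_itv /= => /andP[sq qr].
  have : cut r (pickle q) by exists q.
  rewrite rs => -[q' /(pcan_inj pickleK) -> /(lt_trans sq)].
  by rewrite ltxx.
by move=> r s rs; apply/eqP; rewrite eq_le !cut_le.
Qed.

Lemma coded_homeomorphic {R : realType} S T :
  homeomorphic (set_type (@coded R S)) (set_type (@coded R T)) -> S `<=` T.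
Proof.
move=> h k Sk; apply/(@coded_twin R)/(homeomorphic_twin _ _ _ h).
exact/coded_twin.
Qed.

Lemma homeomorphic_sym {T U : topologicalType} :
  homeomorphic T U -> homeomorphic U T.
Proof. by move=> [f [g [? ? ? ?]]]; exists g, f. Qed.

Theorem theorem1 (R : realType) :
  exists F : set (set R),
    [/\ F #= [set: R],
        (forall K : set R, F K -> compact K),
        (forall K : set R, F K -> forall x : R, K x ->
           ~ exists y : R, connected_component K x = [set y]) &
        (forall K L : set R, F K -> F L -> K <> L ->
           ~ homeomorphic (set_type K) (set_type L))].
Proof.
exists (range (coded \o @cut R)); split.
(* The twins of a coded set recover its cut, so the indexing by reals is injective. *)
- apply: inj_card_eq => r s _ _ /= rs; apply: cut_inj; apply/seteqP.
  by split=> k; rewrite -!(@coded_twin R) rs.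
- by move=> _ [r _ <-]; exact: coded_compact.
- by move=> _ [r _ <-] x; apply: fat_component; exact: coded_fat.
- move=> _ _ [r _ <-] [s _ <-] /= neq hom; apply: neq; congr coded.
  apply/seteqP; split; apply: coded_homeomorphic; first exact: hom.
  exact: homeomorphic_sym hom.
Qed.
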